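(* Let $(\hat{\boldsymbol\beta},\hat{\boldsymbol\theta},\hat\xi,\hat\xi^*,\hat{\mathbf z})$ be an optimal solution of the sparse convex quantile regression problem $$\begin{aligned} \min_{\boldsymbol\beta,\boldsymbol\theta,\xi,\xi^*,\mathbf z}\quad & \frac12\sum_{i=1}^n\|\boldsymbol\beta_i\|_2^2 + C\sum_{i=1}^n\bigl(\tau\xi_i+(1-\tau)\xi_i^*\bigr)\\ \text{s.t.}\quad & y_i-\theta_i\le (1-\tau)\varepsilon+\xi_i,\quad \forall i\in[n],\\ & \theta_i-y_i\le \tau\varepsilon+\xi_i^*,\quad \forall i\in[n],\\ & \theta_i+\boldsymbol\beta_i'(\mathbf x_j-\mathbf x_i)\le\theta_j,\quad \forall i,j\in[n],\\ & |(\boldsymbol\beta_i)_j|\le M z_j,\quad \forall i\in[n],\ j\in[d],\\ & \sum_{j=1}^d z_j\le k,\quad \mathbf z\in\{0,1\}^d,\\ & \xi_i\ge0,\ \xi_i^*\ge0,\quad \forall i\in[n]. \end{aligned}$$ Let $n_-$ be the number of indices $i\in[n]$ with $\hat\xi_i^*>0$ (strictly negative residuals), and let $n_+$ be the number of indices $i\in[n]$ with $\hat\xi_i>0$ (strictly positive residuals). Then $$\frac{n_-}{n}\le\tau\qquad\text{and}\qquad \frac{n_+}{n}\le 1-\tau .$$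
   Context: Notation: $[n]=\{1,\dots,n\}$ and $[d]=\{1,\dots,d\}$; a prime denotes transpose. The data are $(\mathbf x_i,y_i)$, $i\in[n]$, with $\mathbf x_i\in\mathbb R^d$ and $y_i\in\mathbb R$. The parameters are a quantile level $\tau\in(0,1)$, a penalty coefficient $C>0$, an insensitivity parameter $\varepsilon\ge 0$, a big-M constant $M>0$ and a sparsity level $k$ (a positive integer, $k\le d$). The decision variables are $\boldsymbol\beta_i\in\mathbb R^d$ and $\theta_i,\xi_i,\xi_i^*\in\mathbb R$ for $i\in[n]$, and $\mathbf z\in\{0,1\}^d$. *)

(* Defs.v *)
From HB Require Import structures.
From mathcomp Require Import all_boot all_order all_algebra.
From mathcomp Require Import reals.

Set Implicit Arguments.
Unset Strict Implicit.
Unset Printing Implicit Defensive.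

Import Order.TTheory GRing.Theory Num.Theory.
Local Open Scope ring_scope.

Definition dotv (R : realType) (d : nat) (u v : 'cV[R]_d) : R :=
  (u^T *m v) 0 0.

(* Squared Euclidean norm; the norm that MathComp-Analysis puts on matrices is
   the sup norm. *)
Definition sqnorm2 (R : realType) (d : nat) (u : 'cV[R]_d) : R :=
  \sum_(j < d) u j 0 ^+ 2.

Record scqr_point (R : realType) (n d : nat) := ScqrPoint {
  beta : 'I_n -> 'cV[R]_d;
  theta : 'I_n -> R;
  xi : 'I_n -> R;
  xistar : 'I_n -> R;
  zsel : 'I_d -> bool
}.

Definition scqr_objective (R : realType) (n d : nat) (tau C : R)
    (s : scqr_point R n d) : R :=
  2^-1 * (\sum_(i < n) sqnorm2 (beta s i))
  + C * (\sum_(i < n) (tau * xi s i + (1 - tau) * xistar s i)).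

Record scqr_feasible (R : realType) (n d : nat)
    (x : 'I_n -> 'cV[R]_d) (y : 'I_n -> R) (tau eps M : R) (k : nat)
    (s : scqr_point R n d) : Prop := ScqrFeasible {
  feas_pos : forall i, y i - theta s i <= (1 - tau) * eps + xi s i;
  feas_neg : forall i, theta s i - y i <= tau * eps + xistar s i;
  feas_convex : forall i j,
    theta s i + dotv (beta s i) (x j - x i) <= theta s j;
  feas_bigM : forall i (j : 'I_d), `|beta s i j 0| <= M * (zsel s j)%:R;
  feas_sparse : (\sum_(j < d) zsel s j <= k)%N;
  feas_xi : forall i, 0 <= xi s i;
  feas_xistar : forall i, 0 <= xistar s i
}.

Definition scqr_optimal (R : realType) (n d : nat)
    (x : 'I_n -> 'cV[R]_d) (y : 'I_n -> R) (tau C eps M : R) (k : nat)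
    (s : scqr_point R n d) : Prop :=
  scqr_feasible x y tau eps M k s /\
  forall t : scqr_point R n d, scqr_feasible x y tau eps M k t ->
    scqr_objective tau C s <= scqr_objective tau C t.

(* Main.v *)
Require Import Defs.
From HB Require Import structures.
From mathcomp Require Import all_boot all_order all_algebra.
From mathcomp Require Import reals.
From mathcomp Require Import lra.

Set Implicit Arguments.
Unset Strict Implicit.
Unset Printing Implicit Defensive.

Import Order.TTheory GRing.Theory Num.Theory.
Local Open Scope ring_scope.

(** Adding a constant [- c] to every fitted value [theta i] preserves all the
    constraints that do not mention the data [y]: the convexity inequalities
    only involve differences of the [theta i], and the big-M and sparsity
    constraints do not involve them at all.  Hence an optimal point cannot be
    improved by such a shift followed by the cheapest choice of slacks
    ([optimal_le_shifted_loss]).  Shifting by [0] shows that the optimal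
    slacks are already the cheapest ones, i.e. the positive parts of the
    residuals [y i - theta i] beyond the insensitive zone
    ([optimal_slackE]).  The problem restricted to shifts is therefore the
    unconstrained minimisation of [c |-> \sum_i loss (r i + c)], with [loss]
    the insensitive pinball loss and [r i] the residuals.

    The bounds on the counts are the first-order conditions at [c = 0].
    For a small shift [c > 0], a residual strictly below the insensitive zone
    gains [(1 - tau) * c], and any other residual loses at most [tau * c];
    minimality yields [(1 - tau) * n_- <= tau * (n - n_-)], that is
    [n_- <= tau * n] ([card_below_le]).  The bound on [n_+] is the same fact
    after the reflection [r |-> - r], [tau |-> 1 - tau]. *)

(** * The insensitive pinball loss under a common shift *)

(** Slope [p] to the right of the insensitive zone [[- v, u]] and slope
    [- (1 - p)] to its left. *)
Definition pinball (R : realFieldType) (p u v r : R) : R :=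
  p * Num.max 0 (r - u) + (1 - p) * Num.max 0 (- r - v).

Lemma pinballN (R : realFieldType) (p u v r : R) :
  pinball p u v (- r) = pinball (1 - p) v u r.
Proof. by rewrite /pinball opprK subKr addrC. Qed.

Lemma pinball_shift_le (R : realFieldType) (p u v r c : R) :
  0 <= p <= 1 -> 0 <= c -> pinball p u v (r + c) <= pinball p u v r + p * c.
Proof.
move=> /andP[p0 p1] c0.
have hu : Num.max 0 (r + c - u) <= Num.max 0 (r - u) + c.
  by rewrite ge_max !maxEle; apply/andP; split; case: ifP => h; lra.
have hv : Num.max 0 (- (r + c) - v) <= Num.max 0 (- r - v).
  by rewrite ge_max !le_max lexx /=; apply/orP; right; lra.
have := ler_wpM2l p0 hu.
have q0 : 0 <= 1 - p by lra.
have := ler_wpM2l q0 hv.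
rewrite /pinball mulrDr; lra.
Qed.

(** As [- v <= u], a residual that stays below the zone during the shift only
    sees the left slope. *)
Lemma pinball_shift_below (R : realFieldType) (p u v r c : R) :
  0 <= u -> 0 <= v -> 0 <= c -> c <= - r - v ->
  pinball p u v (r + c) = pinball p u v r - (1 - p) * c.
Proof.
move=> u0 v0 c0 hc; rewrite /pinball.
have -> : Num.max 0 (r + c - u) = 0 by apply/max_idPl; lra.
have -> : Num.max 0 (r - u) = 0 by apply/max_idPl; lra.
have -> : Num.max 0 (- (r + c) - v) = - (r + c) - v by apply/max_idPr; lra.
have -> : Num.max 0 (- r - v) = - r - v by apply/max_idPr; lra.
lra.
Qed.

Lemma common_pos_lower_bound (R : realFieldType) (I : finType) (P : pred I)
    (f : I -> R) :
  (forall i, P i -> 0 < f i) -> exists2 c : R, 0 < c & forall i, P i -> c <= f i.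
Proof.
move=> fP; exists (\big[Num.min/1]_(i | P i) f i).
  by elim/big_rec: _ => [|i m Pi m0]; rewrite ?ltr01 // lt_min fP.
by move=> i Pi; exact: bigmin_le_cond.
Qed.

(** First-order condition: the right derivative at [0] of the total loss is
    at most [p * #|I| - n_-] and must be nonnegative. *)
Lemma card_below_le (R : realFieldType) (I : finType) (p u v : R) (r : I -> R) :
  0 <= p <= 1 -> 0 <= u -> 0 <= v ->
  (forall c, \sum_i pinball p u v (r i) <= \sum_i pinball p u v (r i + c)) ->
  #|[set i | 0 < - r i - v]|%:R <= p * #|I|%:R.
Proof.
move=> hp u0 v0 rmin.
have [c c0 hc] := @common_pos_lower_bound R I (fun i => 0 < - r i - v)
  (fun i => - r i - v) (fun i h => h).
have {}rmin : \sum_i pinball p u v (r i) <=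
    \sum_i (pinball p u v (r i) + (p - (0 < - r i - v)%R%:R) * c).
  apply: le_trans (rmin c) _; apply: ler_sum => i _.
  case: ltP => hi.
    by rewrite (pinball_shift_below _ u0 v0 (ltW c0) (hc i hi)) /=; lra.
  by rewrite subr0; exact: pinball_shift_le hp (ltW c0).
move: rmin; rewrite [leRHS]big_split /= lerDl -mulr_suml pmulr_lge0 // sumrB subr_ge0.
by rewrite sumr_const -natr_sum -sum1dep_card -big_mkcond mulr_natr.
Qed.

Lemma card_above_le (R : realFieldType) (I : finType) (p u v : R) (r : I -> R) :
  0 <= p <= 1 -> 0 <= u -> 0 <= v ->
  (forall c, \sum_i pinball p u v (r i) <= \sum_i pinball p u v (r i + c)) ->
  #|[set i | 0 < r i - u]|%:R <= (1 - p) * #|I|%:R.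
Proof.
move=> /andP[p0 p1] u0 v0 rmin.
have hq : 0 <= 1 - p <= 1 by lra.
have := @card_below_le R I (1 - p) v u (fun i => - r i) hq v0 u0.
under eq_finset do rewrite opprK.
apply=> c; have := rmin (- c).
under eq_bigr do rewrite -[r _]opprK pinballN.
by under [leRHS]eq_bigr do rewrite -[r _]opprK -opprD pinballN.
Qed.

(** * Optimal points and common shifts *)

Lemma optimal_le_shifted_loss (R : realType) (n d k : nat)
    (x : 'I_n -> 'cV[R]_d) (y : 'I_n -> R) (tau C eps M : R)
    (s : scqr_point R n d) (c : R) :
  0 < C -> scqr_optimal x y tau C eps M k s ->
  \sum_i (tau * xi s i + (1 - tau) * xistar s i) <=
  \sum_i pinball tau ((1 - tau) * eps) (tau * eps) (y i - theta s i + c).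
Proof.
move=> C0 [[_ _ hcvx hM hk _ _] smin].
pose t := ScqrPoint (beta s) (fun i => theta s i - c)
  (fun i => Num.max 0 (y i - theta s i + c - (1 - tau) * eps))
  (fun i => Num.max 0 (- (y i - theta s i + c) - tau * eps)) (zsel s).
have tF : scqr_feasible x y tau eps M k t.
  split=> //= [i|i|i j|i|i].
  - by rewrite -lerBlDl le_max; apply/orP; right; lra.
  - by rewrite -lerBlDl le_max; apply/orP; right; lra.
  - by rewrite addrAC lerD2r hcvx.
  - by rewrite le_max lexx.
  - by rewrite le_max lexx.
by have := smin t tF; rewrite /scqr_objective lerD2l ler_pM2l.
Qed.

(** Feasible slacks dominate the positive parts, whose total cost is already
    at least the optimum; both weights being positive, no slack exceeds its
    positive part. *)
Lemma optimal_slackE (R : realType) (n d k : nat)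
    (x : 'I_n -> 'cV[R]_d) (y : 'I_n -> R) (tau C eps M : R)
    (s : scqr_point R n d) :
  0 < tau < 1 -> 0 < C -> scqr_optimal x y tau C eps M k s -> forall i,
  xi s i = Num.max 0 (y i - theta s i - (1 - tau) * eps) /\
  xistar s i = Num.max 0 (- (y i - theta s i) - tau * eps).
Proof.
move=> /andP[t0 t1] C0 hs.
have q0 : 0 < 1 - tau by lra.
set a := fun i => Num.max 0 (y i - theta s i - (1 - tau) * eps).
set b := fun i => Num.max 0 (- (y i - theta s i) - tau * eps).
have [[hpos hneg _ _ _ hxi hxis] _] := hs.
have ha i : 0 <= tau * (xi s i - a i).
  rewrite pmulr_rge0 // subr_ge0 ge_max hxi /=.
  by have := hpos i; lra.
have hb i : 0 <= (1 - tau) * (xistar s i - b i).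
  rewrite pmulr_rge0 // subr_ge0 ge_max hxis /=.
  by have := hneg i; lra.
have sum0 : \sum_i (tau * (xi s i - a i) + (1 - tau) * (xistar s i - b i)) = 0.
  apply/le_anti; rewrite sumr_ge0 ?andbT; last by move=> i _; rewrite addr_ge0.
  have := optimal_le_shifted_loss 0 C0 hs; rewrite -subr_le0 -sumrB.
  apply: le_trans; apply: ler_sum => i _.
  by rewrite addr0 /pinball -/(a i) -/(b i); lra.
move=> i.
have /(_ i isT)/eqP := psumr_eq0P (fun i _ => addr_ge0 (ha i) (hb i)) sum0.
rewrite paddr_eq0 // !mulf_eq0 (gt_eqF t0) (gt_eqF q0) /= !subr_eq0.
by move=> /andP[/eqP-> /eqP->].
Qed.

Theorem theorem1 (R : realType) (n d k : nat)
    (x : 'I_n -> 'cV[R]_d) (y : 'I_n -> R) (tau C eps M : R)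
    (hn : (0 < n)%N) (hk : (0 < k <= d)%N)
    (htau : 0 < tau < 1) (hC : 0 < C) (heps : 0 <= eps) (hM : 0 < M)
    (s : scqr_point R n d) (hs : scqr_optimal x y tau C eps M k s) :
  #|[set i : 'I_n | 0 < xistar s i]|%:R / n%:R <= tau /\
  #|[set i : 'I_n | 0 < xi s i]|%:R / n%:R <= 1 - tau.
Proof.
have slackE := optimal_slackE htau hC hs.
have /andP[t0 t1] := htau.
have u0 : 0 <= (1 - tau) * eps by rewrite mulr_ge0 //; lra.
have v0 : 0 <= tau * eps by rewrite mulr_ge0 //; lra.
have tau01 : 0 <= tau <= 1 by lra.
have rmin c : \sum_i pinball tau ((1 - tau) * eps) (tau * eps)
      (y i - theta s i) <=
    \sum_i pinball tau ((1 - tau) * eps) (tau * eps) (y i - theta s i + c).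
  apply: le_trans (optimal_le_shifted_loss c hC hs); apply: ler_sum => i _.
  by have [-> ->] := slackE i.
have n0 : 0 < n%:R :> R by rewrite ltr0n.
rewrite !ler_pdivrMr //.
split.
  have := card_below_le tau01 u0 v0 rmin.
  rewrite card_ord; apply: le_trans.
  rewrite ler_nat subset_leq_card //; apply/subsetP=> i; rewrite !inE.
  by have [_ ->] := slackE i; rewrite lt_max ltxx.
have := card_above_le tau01 u0 v0 rmin.
rewrite card_ord; apply: le_trans.
rewrite ler_nat subset_leq_card //; apply/subsetP=> i; rewrite !inE.
by have [-> _] := slackE i; rewrite lt_max ltxx.
Qed.
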